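(* Let $a,b,c$ be non-negative real numbers with $a+b+c=1$, and let $E(i_n(a,b,c))$ be the expected value of the number of independent sets of the random hexagonal cactus $R_n(a,b,c)$. Put \[\sigma_1=\sqrt{9a^2+42ab+30ac+130a+49b^2+70bc+26b+25c^2+78c+25},\quad \sigma_2=25a-11b+7c,\quad \sigma_3=9a^2+49b^2+25c^2-20+53a-15b+19c.\] Then, as $n\to\infty$, \[ E(i_n(a,b,c))\approx \frac{\frac{1}{0.5^{n+1}}\left(-3a\sigma_1-7b\sigma_1-5c\sigma_1+42ab+30ac+70bc+4\sigma_1+\sigma_3\right)}{\left(-\frac{3a+7b+5c-\sigma_1+5}{\sigma_2}\right)^{n+1}\sigma_1\sigma_2}, \] where $\approx$ means asymptotic equivalence (the ratio of the two sides tends to $1$).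
   Context: An independent set of a graph is a set of vertices no two of which are adjacent (the empty set counts as an independent set; the empty graph has exactly one independent set). A hexagon is a cycle $C_6$. The random hexagonal cactus $R_n(a,b,c)$, for non-negative reals $a,b,c$ with $a+b+c=1$, is defined recursively: $R_0(a,b,c)$ is the empty graph; $R_1(a,b,c)$ is a hexagon; $R_2(a,b,c)$ is obtained from two hexagons by identifying one vertex of one with one vertex of the other. For $n\ge 3$, label the hexagons of $R_{n-1}(a,b,c)$ as $1,\dots,n-1$ consecutively along the chain; the $(n-1)$-th hexagon contains a cut vertex $v$ (shared with the $(n-2)$-th hexagon). Then $R_n(a,b,c)$ is obtained from $R_{n-1}(a,b,c)$ and a new hexagon $H$ by identifying a vertex of $H$ with a vertex of the $(n-1)$-th hexagon that is at distance one from $v$ with probability $a$, at distance two from $v$ with probability $b$, or at distance three from $v$ with probability $c$ (distances measured in the $(n-1)$-th hexagon), independently at each step.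
   Formalization: The formal theorem adds the hypothesis σ₂ = 25a − 11b + 7c ≠ 0, since the displayed formula divides by σ₂ and is undefined when σ₂ = 0 (e.g. a = 11/36, b = 25/36, c = 0). *)

(* Defs.v *)
From HB Require Import structures.
From mathcomp Require Import all_boot all_order all_algebra.
From mathcomp Require Import all_classical all_reals all_analysis.
Set Implicit Arguments.
Unset Strict Implicit.
Unset Printing Implicit Defensive.
Import Order.TTheory GRing.Theory Num.Theory.
Import numFieldNormedType.Exports.

Structure graph := Graph {
  vertex :> finType;
  adj : rel vertex;
  adj_sym : symmetric adj;
  adj_irr : irreflexive adj }.

Definition independent (G : graph) (A : {set G}) : bool :=
  [forall x in A, forall y in A, ~~ adj x y].

Definition num_indep (G : graph) : nat :=
  #|[set A : {set G} | independent A]|.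

(* Length of a shortest walk from x to y; the value is #|G| when y cannot be
   reached from x. *)
Definition gdist (G : graph) (x y : G) : nat :=
  find (fun l => [exists p : l.-tuple G, path (@adj G) x p && (last x p == y)])
       (iota 0 #|G|).

Definition empty_adj : rel void := fun _ _ => false.

Lemma empty_adj_sym : symmetric empty_adj. Proof. by []. Qed.

Lemma empty_adj_irr : irreflexive empty_adj. Proof. by []. Qed.

Definition empty_graph : graph := Graph empty_adj_sym empty_adj_irr.

Definition hex_adj : rel 'I_6 := fun i j => (j == ordS i) || (i == ordS j).

Lemma hex_adj_sym : symmetric hex_adj.
Proof. by move=> i j; rewrite /hex_adj orbC. Qed.

Lemma hex_adj_irr : irreflexive hex_adj.
Proof. by case; do 6?[case=> //]. Qed.

Definition hexagon : graph := Graph hex_adj_sym hex_adj_irr.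

(* The disjoint union of G and H with the vertex v of H identified with the
   vertex u of G: the merged vertex is represented by inl u. *)
Section Glue.
Variables (G H : graph) (u : G) (v : H).

Definition glue_vertex : finType := (G + {x : H | x != v})%type.

Definition glue_adj : rel glue_vertex := fun x y =>
  match x, y with
  | inl x, inl y => adj x y
  | inr x, inr y => adj (val x) (val y)
  | inl x, inr y => (x == u) && adj v (val y)
  | inr x, inl y => (y == u) && adj v (val x)
  end.

Lemma glue_adj_sym : symmetric glue_adj.
Proof. by move=> [x|x] [y|y] //=; rewrite adj_sym. Qed.

Lemma glue_adj_irr : irreflexive glue_adj.
Proof. by move=> [x|x] /=; rewrite adj_irr. Qed.

Definition glue : graph := Graph glue_adj_sym glue_adj_irr.

Definition glue_inr (x : H) : glue :=
  if insub x is Some y then inr y else inl u.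

End Glue.

(* A chain of hexagons together with the cyclic labelling of its last hexagon.
   When there are at least two hexagons, label 0 is the cut vertex shared with
   the last but one. *)
Record hex_chain := HexChain {
  chain_graph : graph;
  last_hex : hexagon -> chain_graph }.

Definition attach (C : hex_chain) (j : hexagon) : hex_chain :=
  HexChain (@glue_inr (chain_graph C) hexagon (@last_hex C j) ord0).

(* chain s m has m.+1 hexagons. The second hexagon is attached at an arbitrary
   vertex of the first one; later hexagons are attached at the vertices s_0,
   s_1, ... of the hexagon that is then the last one. *)
Fixpoint chain (s : seq hexagon) (m : nat) : hex_chain :=
  if m isn't m'.+1 then @HexChain hexagon id
  else attach (chain s m') (if m' is k.+1 then nth ord0 s k else ord0).

Definition cactus (s : seq hexagon) (n : nat) : graph :=
  if n is m.+1 then chain_graph (chain s m) else empty_graph.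

Local Open Scope ring_scope.

(* p j is the probability of attaching the next hexagon at the vertex labelled
   j. Only the law of its distance to the cut vertex is prescribed: the way the
   two vertices at distance one (or two) share the mass a (or b) is free. *)
Definition step_law (R : realType) (a b c : R) (p : hexagon -> R) : Prop :=
  [/\ forall j, 0 <= p j,
      \sum_j p j = 1,
      \sum_(j | gdist (ord0 : hexagon) j == 1%N) p j = a,
      \sum_(j | gdist (ord0 : hexagon) j == 2%N) p j = b &
      \sum_(j | gdist (ord0 : hexagon) j == 3%N) p j = c].

(* The n - 2 random choices are independent, hence the product weights. *)
Definition expected_num_indep (R : realType) (p : nat -> hexagon -> R)
    (n : nat) : R :=
  \sum_(s : (n - 2).-tuple hexagon)
    (\prod_(k < n - 2) p k (tnth s k)) * (num_indep (cactus s n))%:R.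

Section Sigma.
Variables (R : realType) (a b c : R).

Definition sigma1 : R :=
  Num.sqrt (9 * a ^+ 2 + 42 * a * b + 30 * a * c + 130 * a + 49 * b ^+ 2
            + 70 * b * c + 26 * b + 25 * c ^+ 2 + 78 * c + 25).

Definition sigma2 : R := 25 * a - 11 * b + 7 * c.

Definition sigma3 : R :=
  9 * a ^+ 2 + 49 * b ^+ 2 + 25 * c ^+ 2 - 20 + 53 * a - 15 * b + 19 * c.

End Sigma.

(* Main.v *)
Require Import Defs.
From HB Require Import structures.
From mathcomp Require Import all_boot all_order all_algebra.
From mathcomp Require Import all_classical all_reals all_analysis.
From mathcomp Require Import ring lra.
Import Order.TTheory GRing.Theory Num.Theory.
Import numFieldNormedType.Exports.
Local Open Scope ring_scope.
Set Implicit Arguments.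
Unset Strict Implicit.

(* An independent set of a chain extended by a hexagon is a pair of independent
   sets of the chain and of the hexagon that agree on the merged vertex.  Hence
   the expected numbers (x, y) of independent sets avoiding, resp. containing,
   the next attachment vertex evolve by the constant symmetric matrix
     M = [[8a+10b+9c, 5a+3b+4c], [5a+3b+4c, 2b+c]],
   starting from (13, 5), and E(i_n) = 13 x + 5 y.  When a + b + c = 1, M has
   trace t = 3a+7b+5c+5 and determinant -sigma2, so its eigenvalues are
   r, s = (t +- sigma1) / 2, and E(i_n) = A r^n + B s^n with
   A = (18 - 2s) / sigma1 > 0 and |s| < r.  The right-hand side of the theorem
   is exactly A r^n, because r s = - sigma2. *)

Lemma big_tuple_rcons (R : Type) (idx : R) (op : Monoid.com_law idx)
    (T : finType) (m : nat) (F : seq T -> R) :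
  \big[op/idx]_(s : m.+1.-tuple T) F s
  = \big[op/idx]_(s : m.-tuple T) \big[op/idx]_(x : T) F (rcons s x).
Proof.
rewrite pair_big /=.
rewrite (reindex (fun sx : m.-tuple T * T => [tuple of rcons sx.1 sx.2])) //=.
apply/onW_bij/inj_card_bij; last by rewrite card_prod !card_tuple expnSr.
move=> [s x] [t y] /(congr1 val) /= /rcons_inj[st ->].
by congr pair; apply: val_inj.
Qed.

(** * Independent sets with prescribed membership at one or two vertices *)

Section IndependentSets.
Local Open Scope nat_scope.
Local Open Scope bool_scope.

Lemma independentP (G : graph) (A : {set G}) :
  reflect (forall x y, x \in A -> y \in A -> ~~ adj x y) (independent A).
Proof.
apply: (iffP 'forall_implyP) => [hA x y xA yA|hA x xA].
  by have /forall_inP/(_ y yA) := hA x xA.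
by apply/forall_inP => y; apply: hA.
Qed.

Definition indep1 (G : graph) (x : G) (b : bool) : nat :=
  #|[set A : {set G} | independent A && ((x \in A) == b)]|.

Definition indep2 (G : graph) (x y : G) (b b' : bool) : nat :=
  #|[set A : {set G} | [&& independent A, (x \in A) == b & (y \in A) == b']]|.

Lemma num_indep_split (G : graph) (x : G) :
  num_indep G = indep1 x false + indep1 x true.
Proof.
rewrite /num_indep /indep1 -(cardsID [set A : {set G} | x \in A]) addnC.
by congr (_ + _); apply: eq_card => A; rewrite !inE;
   case: (x \in A); rewrite /= ?andbT ?andbF.
Qed.

Lemma indep1_split (G : graph) (x y : G) (b : bool) :
  indep1 y b = indep2 x y false b + indep2 x y true b.
Proof.
rewrite /indep1 /indep2 -(cardsID [set A : {set G} | x \in A]) addnC.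
by congr (_ + _); apply: eq_card => A; rewrite !inE;
   case: (x \in A); rewrite /= ?andbT ?andbF.
Qed.

(** * Two graphs glued at a vertex *)

Section Glue.
Variables (G H : graph) (u : G) (v : H).
Notation K := (Defs.glue u v).

Lemma glue_inr_root : glue_inr u v v = inl u.
Proof. by rewrite /glue_inr insubF // eqxx. Qed.

Lemma glue_inr_val (x : {x : H | x != v}) : glue_inr u v (val x) = inr x.
Proof. by rewrite /glue_inr valK. Qed.

Lemma adj_glue_inr (x y : H) :
  adj (glue_inr u v x) (glue_inr u v y) = adj x y.
Proof.
have [->|nx] := eqVneq x v; have [->|ny] := eqVneq y v;
  rewrite ?glue_inr_root.
- by rewrite !adj_irr.
- by rewrite -[y]/(val (Sub y ny : {x : H | x != v})) glue_inr_val /= eqxx.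
- by rewrite -[x]/(val (Sub x nx : {x : H | x != v})) glue_inr_val /= eqxx adj_sym.
rewrite -[y]/(val (Sub y ny : {x : H | x != v})) glue_inr_val.
by rewrite -[x]/(val (Sub x nx : {x : H | x != v})) glue_inr_val.
Qed.

(** The merged vertex is seen by both traces, as [u] and as [v]. *)
Let restr (S : {set K}) : {set G} * {set H} :=
  ([set x | (inl x : K) \in S], [set y | glue_inr u v y \in S]).

Lemma restr_inj : injective restr.
Proof.
move=> S T [/setP eG /setP eH]; apply/setP => -[x|y].
  by have := eG x; rewrite !inE.
by have := eH (val y); rewrite !inE glue_inr_val.
Qed.

(** Every edge of the glued graph lies inside one part: an edge from [inl x] to [inr y] forces
    [x = u], and [inl u] is also the image of [v]. *)
Lemma independent_glue (S : {set K}) :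
  independent S = independent (restr S).1 && independent (restr S).2.
Proof.
apply/independentP/andP => [hS|[/independentP hG /independentP hH]].
  split; apply/independentP => x y; rewrite !inE => xS yS.
    exact: hS xS yS.
  by rewrite -adj_glue_inr; exact: hS.
move=> [x|x] [y|y] xS yS /=.
- by apply: hG; rewrite inE.
- have [xu|//] := eqVneq x u; apply: hH; rewrite inE ?glue_inr_val //.
  by rewrite glue_inr_root -xu.
- have [yu|//] := eqVneq y u; apply: hH; rewrite inE ?glue_inr_val //.
  by rewrite glue_inr_root -yu.
by apply: hH; rewrite inE glue_inr_val.
Qed.

(* Independent sets of the glued graph are pairs of independent sets of the two
   parts that agree on the merged vertex. *)
Lemma indep2_glue (y : H) (b b' : bool) :
  indep2 (inl u : K) (glue_inr u v y) b b' = indep1 u b * indep2 v y b b'.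
Proof.
rewrite /indep1 /indep2 -cardsX -(card_imset _ restr_inj).
apply: eq_card => -[A B]; rewrite !inE /=; apply/imsetP/idP => [[S]|].
  rewrite !inE independent_glue => /and3P[/andP[iA iB] /eqP uS yS] [-> ->].
  by rewrite iA iB !inE glue_inr_root uS eqxx.
case/and4P => /andP[iA /eqP uA] iB /eqP vB yB.
(* The merged vertex is read off [A]; [B] agrees there because both memberships equal [b]. *)
pose S : {set K} :=
  [set z | match z with inl x => x \in A | inr y => val y \in B end].
have inrS x : (glue_inr u v x \in S) = (x \in B).
  have [->|nx] := eqVneq x v; first by rewrite glue_inr_root inE uA vB.
  by rewrite -[x]/(val (Sub x nx : {x : H | x != v})) glue_inr_val inE.
have rS : restr S = (A, B).
  by congr pair; apply/setP => x; rewrite inE ?inrS // inE.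
by exists S; rewrite // inE independent_glue rS /= iA iB inrS inE uA yB eqxx.
Qed.

Lemma indep1_glue (y : H) (b : bool) :
  indep1 (glue_inr u v y) b
  = indep1 u false * indep2 v y false b + indep1 u true * indep2 v y true b.
Proof. by rewrite (indep1_split (inl u : K)) !indep2_glue. Qed.

End Glue.

(** * Counting in a single hexagon *)

Fixpoint sum_bits (n : nat) (f : seq bool -> nat) : nat :=
  if n isn't m.+1 then f [::]
  else sum_bits m (fun s => f (rcons s true) + f (rcons s false)).

Lemma sum_bitsE (n : nat) (f : seq bool -> nat) :
  \sum_(s : n.-tuple bool) f s = sum_bits n f.
Proof.
elim: n f => [|n IHn] f.
  by rewrite (big_pred1 [tuple]) => [|s] /=; [|apply/esym/eqP; exact: tuple0].
rewrite big_tuple_rcons /= -IHn.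
by apply: eq_bigr => s _; rewrite big_bool.
Qed.

Definition hex_indep (s : seq bool) : bool :=
  all (fun i => ~~ (nth false s i && nth false s (i.+1 %% 6))) (iota 0 6).

(** Trades a cardinal of sets for a recursion over bit strings that evaluates, so the tables below
    follow by computation. *)
Lemma indep2_hexagon (k : hexagon) (b b' : bool) :
  indep2 (ord0 : hexagon) k b b'
  = sum_bits 6
      (fun s => [&& hex_indep s, nth false s 0 == b & nth false s k == b']).
Proof.
rewrite -sum_bitsE /indep2 cardsE -sum1_card.
pose h (s : 6.-tuple bool) : {set hexagon} := [set i | tnth s i].
have hE s i : (i \in h s) = nth false s i by rewrite inE (tnth_nth false).
have h_bij : bijective h.
  exists (fun A : {set hexagon} => [tuple i \in A | i < 6]) => [s|A].
    by apply: eq_from_tnth => i; rewrite tnth_mktuple inE.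
  by apply/setP => i; rewrite inE tnth_mktuple.
rewrite (reindex h) /=; last exact/onW_bij.
rewrite big_mkcond; apply: eq_bigr => s _ /=; rewrite unfold_in !hE /=.
suff -> : independent (h s) = hex_indep s by case: ifP.
apply/independentP/allP => [hI i|hI x y].
  rewrite mem_iota /= => i6; apply/negP => /andP[si si'].
  have := hI (Ordinal i6) (ordS (Ordinal i6)); rewrite !hE /= si si'.
  by move=> /(_ isT isT) /=; rewrite /hex_adj eqxx.
rewrite !hE => sx sy; apply/norP; split; apply/negP => /eqP e.
  by have := hI x; rewrite mem_iota ltn_ord sx -[_ %% 6]/(val (ordS x)) -e sy => /(_ isT).
by have := hI y; rewrite mem_iota ltn_ord sy -[_ %% 6]/(val (ordS y)) -e sx => /(_ isT).
Qed.

Lemma indep2_hexagon_tt (k : hexagon) :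
  indep2 (ord0 : hexagon) k true true = nth 0 [:: 5; 0; 2; 1; 2; 0] k.
Proof. by rewrite indep2_hexagon; case: k; do 6?[case=> //]. Qed.

Lemma indep2_hexagon_ff (k : hexagon) :
  indep2 (ord0 : hexagon) k false false = nth 0 [:: 13; 8; 10; 9; 10; 8] k.
Proof. by rewrite indep2_hexagon; case: k; do 6?[case=> //]. Qed.

Lemma indep2_hexagon_tf (k : hexagon) :
  indep2 (ord0 : hexagon) k true false = nth 0 [:: 0; 5; 3; 4; 3; 5] k.
Proof. by rewrite indep2_hexagon; case: k; do 6?[case=> //]. Qed.

Lemma indep2_hexagon_ft (k : hexagon) :
  indep2 (ord0 : hexagon) k false true = nth 0 [:: 0; 5; 3; 4; 3; 5] k.
Proof. by rewrite indep2_hexagon; case: k; do 6?[case=> //]. Qed.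

Lemma indep1_hexagon (b : bool) :
  indep1 (ord0 : hexagon) b = if b then 5 else 13.
Proof. by rewrite (indep1_split (ord0 : hexagon)) !indep2_hexagon; case: b. Qed.

(** * Distances in the hexagon *)

Fixpoint walks (G : graph) (l : nat) (x y : G) : bool :=
  if l isn't l'.+1 then x == y else [exists z, adj x z && walks l' z y].

Lemma walksE (G : graph) (l : nat) (x y : G) :
  [exists p : l.-tuple G, path (@adj G) x p && (last x p == y)] = walks l x y.
Proof.
elim: l x => [|l IHl] x /=.
  apply/existsP/idP => [[p]|xy]; first by rewrite tuple0.
  by exists [tuple].
apply/existsP/existsP => [[p]|[z /andP[xz]]].
  case/tupleP: p => z p /= /andP[/andP[xz zp] py].
  by exists z; rewrite xz -IHl; apply/existsP; exists p; rewrite zp.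
rewrite -IHl => /existsP[p /andP[zp py]].
by exists [tuple of z :: p]; rewrite /= xz zp.
Qed.

Lemma gdist_hexagon (j : hexagon) :
  gdist (ord0 : hexagon) j = nth 0 [:: 0; 1; 2; 3; 2; 1] j.
Proof.
rewrite /gdist card_ord; under eq_find do rewrite walksE.
(* On plain numbers the two neighbours of i are i + 1 and i + 5 modulo 6, so the search in [gdist]
   can be evaluated. *)
pose w := fix w l i j := if l isn't l'.+1 then i == j else
   w l' (i.+1 %% 6) j || w l' ((i + 5) %% 6) j.
have wE l (i : hexagon) : walks l i j = w l i j.
  elim: l i => //= l IHl i.
  apply/existsP/orP => [[z /andP[/orP[]/eqP]]|].
  - by move=> ->; rewrite IHl; left.
  - by move=> ->; rewrite IHl /= modnDml addSnnS modnDr (modn_small (ltn_ord z)); right.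
  case=> H.
    by exists (ordS i); rewrite IHl H /= /hex_adj eqxx.
  exists (ord_pred i); rewrite IHl /= -subn1 -addnBA // H andbT.
  by rewrite /hex_adj ord_predK eqxx orbT.
under eq_find do rewrite wE.
by clear wE; case: j; do 6?[case=> //].
Qed.

End IndependentSets.

(** * Random chains and the linear recursion for the expectations *)

Definition attach_at (s : seq hexagon) (m : nat) : hexagon :=
  if m is k.+1 then nth ord0 s k else ord0.

(** The second hexagon uses no entry of [s], so [chain s m] reads only the first m - 1 entries. *)
Lemma chain_rcons (s : seq hexagon) (x : hexagon) (m : nat) :
  (m <= (size s).+1)%N -> chain (rcons s x) m = chain s m.
Proof.
elim: m => //= m IHm lem; rewrite IHm 1?ltnW //; congr attach.
by case: m lem {IHm} => // m lem; rewrite nth_rcons (ltnSE lem).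
Qed.

Lemma attach_at_rcons (s : seq hexagon) (x : hexagon) (m : nat) :
  (m <= size s)%N -> attach_at (rcons s x) m = attach_at s m.
Proof. by case: m => //= m lem; rewrite nth_rcons lem. Qed.

(* Expected number of independent sets of the chain of m.+1 hexagons that
   contain (b = true) or avoid (b = false) the vertex carrying the next one. *)
Definition expected_at (R : realType) (p : nat -> hexagon -> R) (m : nat)
    (b : bool) : R :=
  \sum_(s : m.-tuple hexagon) (\prod_(k < m) p k (nth ord0 s k)) *
     (indep1 (@last_hex (chain s m) (attach_at s m)) b)%:R.

Section Expectation.
Variables (R : realType) (a b c : R) (p : nat -> hexagon -> R).
Hypotheses (habc : a + b + c = 1) (hp : forall k, step_law a b c (p k)).

Lemma big_hexagon (f : hexagon -> R) :
  \sum_j f j = f (inord 0) + f (inord 1) + f (inord 2) + f (inord 3)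
               + f (inord 4) + f (inord 5).
Proof.
rewrite !big_ord_recr big_ord0 /= add0r.
by do !congr (_ + _); congr f; apply: val_inj; rewrite /= inordK.
Qed.

(** When [f] is invariant under the reflection fixing labels 0 and 3, the way mass is shared between
    labels 1 and 5, or 2 and 4, does not matter. *)
Lemma step_lawE (k : nat) (f : hexagon -> R) :
    f (inord 1) = f (inord 5) -> f (inord 2) = f (inord 4) ->
  \sum_j p k j * f j
  = a * f (inord 1) + b * f (inord 2) + c * f (inord 3).
Proof.
move=> f15 f24; case: (hp k) => _ s1 sa sb sc; move: s1 sa sb sc.
rewrite !big_hexagon -f15 -f24 => s1.
rewrite !(big_mkcond (fun _ => gdist _ _ == _)) !big_hexagon !gdist_hexagon.
rewrite !inordK //= => sa sb sc.
(* Labels 1 to 5 already carry the total mass a + b + c = 1. *)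
have p0 : p k (inord 0) = 0.
  by move: (s1 : _ = _ :> R) (habc : _ = _ :> R) => {}s1 {}abc1; lra.
by rewrite -sa -sb -sc p0; ring.
Qed.

Lemma expected_at0 (e : bool) : expected_at p 0 e = if e then 5 else 13.
Proof.
rewrite /expected_at (big_pred1 [tuple]) => [|s] /=.
  by rewrite big_ord0 mul1r indep1_hexagon; case: e.
by apply/esym/eqP; exact: tuple0.
Qed.

(** Condition on the last choice [j]: the product weight factors, the first m + 1 hexagons do not
    depend on [j], and the new one is glued at its vertex 0 and left at [j]. *)
Lemma expected_atS (m : nat) (e : bool) :
  expected_at p m.+1 e
  = \sum_j p m j *
      (expected_at p m false * (indep2 (ord0 : hexagon) j false e)%:R
       + expected_at p m true * (indep2 (ord0 : hexagon) j true e)%:R).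
Proof.
rewrite /expected_at.
rewrite (@big_tuple_rcons _ _ _ hexagon m (fun s : seq hexagon =>
  (\prod_(k < m.+1) p k (nth ord0 s k)) *
     (indep1 (@last_hex (chain s m.+1) (attach_at s m.+1)) e)%:R)).
rewrite exchange_big /=; apply: eq_bigr => j _.
rewrite !mulr_suml -big_split mulr_sumr; apply: eq_bigr => s _ /=.
rewrite chain_rcons ?size_tuple // nth_rcons size_tuple ltnn eqxx.
rewrite -/(attach_at (rcons s j) m) attach_at_rcons ?size_tuple //.
rewrite indep1_glue natrD !natrM big_ord_recr /=.
rewrite nth_rcons size_tuple ltnn eqxx.
under eq_bigr => k _ do rewrite nth_rcons size_tuple ltn_ord.
by ring.
Qed.

Lemma expected_num_indepE (m : nat) :
  expected_num_indep p m.+2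
  = 13 * expected_at p m false + 5 * expected_at p m true.
Proof.
rewrite /expected_num_indep (_ : (m.+2 - 2)%N = m); last by rewrite -addn2 addnK.
rewrite /expected_at !mulr_sumr -big_split; apply: eq_bigr => s _.
under eq_bigr => k _ do rewrite (tnth_nth ord0).
rewrite /cactus [chain _ _]/= -/(attach_at s m).
(* Splitting at the merged vertex itself makes the mixed counts vanish and leaves the weights 13 and
   5. *)
rewrite (num_indep_split
  (glue_inr (@last_hex (chain s m) (attach_at s m)) (ord0 : hexagon) ord0)).
rewrite !indep1_glue indep2_hexagon_tt indep2_hexagon_ff indep2_hexagon_tf.
rewrite indep2_hexagon_ft.
by rewrite !(natrD, natrM) /=; ring.
Qed.

Lemma expected_at_avoidS (m : nat) :
  expected_at p m.+1 false = (8 * a + 10 * b + 9 * c) * expected_at p m false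
     + (5 * a + 3 * b + 4 * c) * expected_at p m true.
Proof.
rewrite expected_atS step_lawE ?indep2_hexagon_ff ?indep2_hexagon_tf ?inordK //=.
ring.
Qed.

Lemma expected_at_inS (m : nat) :
  expected_at p m.+1 true = (5 * a + 3 * b + 4 * c) * expected_at p m false
     + (2 * b + c) * expected_at p m true.
Proof.
rewrite expected_atS step_lawE ?indep2_hexagon_ft ?indep2_hexagon_tt ?inordK //=.
ring.
Qed.

End Expectation.

(** * Closed form and asymptotics *)

Lemma linear_recurrence2 (R : comPzRingType) (r s A B : R) (u : nat -> R) :
    u 0%N = A + B -> u 1%N = A * r + B * s ->
    (forall n, u n.+2 = (r + s) * u n.+1 - r * s * u n) ->
  forall n, u n = A * r ^+ n + B * s ^+ n.
Proof.
move=> u0 u1 uS n; suff [] : u n = A * r ^+ n + B * s ^+ n /\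
    u n.+1 = A * r ^+ n.+1 + B * s ^+ n.+1 by [].
elim: n => [|n [IHn IHn1]]; first by rewrite u0 u1 !expr0 !expr1 !mulr1.
by split=> //; rewrite uS IHn IHn1 !exprS; ring.
Qed.

Unset Implicit Arguments.
Local Open Scope classical_set_scope.
Local Open Scope ring_scope.

Theorem theorem6 (R : realType) (a b c : R) (p : nat -> hexagon -> R)
    (ha : 0 <= a) (hb : 0 <= b) (hc : 0 <= c) (habc : a + b + c = 1)
    (hp : forall k, step_law a b c (p k))
    (hs2 : sigma2 a b c != 0) :
  let s1 := sigma1 a b c in
  let s2 := sigma2 a b c in
  let s3 := sigma3 a b c in
  (fun n : nat => expected_num_indep p n /
     ((1 / (1 / 2) ^+ n.+1
        * (- 3 * a * s1 - 7 * b * s1 - 5 * c * s1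
           + 42 * a * b + 30 * a * c + 70 * b * c + 4 * s1 + s3))
      / ((- ((3 * a + 7 * b + 5 * c - s1 + 5) / s2)) ^+ n.+1 * s1 * s2)))
    @ \oo --> (1 : R).
Proof.
move=> s1 s2 s3.
have c_def : c = 1 - a - b by rewrite -habc; ring.
pose t := 3 * a + 7 * b + 5 * c + 5.
have t_gt0 : 0 < t by rewrite /t; lra.
have t_lt18 : t < 18 by rewrite /t; lra.
have s1_sqr : s1 ^+ 2 = t ^+ 2 + 4 * s2.
  rewrite /s1 /sigma1 sqr_sqrtr.
    by rewrite /t /s2 /sigma2 c_def; ring.
  by rewrite !addr_ge0 ?mulr_ge0 ?exprn_ge0.
have s1_gt0 : 0 < s1.
  rewrite /s1 /sigma1 sqrtr_gt0 ltr_wpDl ?ltr0n //.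
  by rewrite !addr_ge0 ?mulr_ge0 ?exprn_ge0.
have [r rE] : {r | r = (t + s1) / 2} by exists ((t + s1) / 2).
have [s sE] : {s | s = (t - s1) / 2} by exists ((t - s1) / 2).
have rs : r * s = - s2.
  have -> : r * s = (t ^+ 2 - s1 ^+ 2) / 4 by rewrite rE sE; field.
  by rewrite s1_sqr; field.
have r_gt0 : 0 < r by rewrite rE; lra.
have s_neq0 : s != 0.
  by apply: contra_neq hs2 => s0; apply/eqP; rewrite -oppr_eq0 -rs s0 mulr0.
pose A := (18 - 2 * s) / s1; pose B := (2 * r - 18) / s1.
have A_gt0 : 0 < A by rewrite divr_gt0 // sE; lra.
have s1E : s1 = r - s by rewrite rE sE; field.
have rDs : r + s = t by rewrite rE sE; field.
have rs_neq0 : r - s != 0 by rewrite -s1E lt0r_neq0.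
have AB n : expected_num_indep p n.+2 = A * r ^+ n.+2 + B * s ^+ n.+2.
  rewrite (@linear_recurrence2 _ r s (A * r ^+ 2) (B * s ^+ 2)
    (fun n => expected_num_indep p n.+2)); first by rewrite !exprS; ring.
  - rewrite expected_num_indepE !expected_at0.
    have -> : A * r ^+ 2 + B * s ^+ 2 = 18 * (r + s) - 2 * (r * s).
      by rewrite /A /B s1E; field.
    by rewrite rs rDs /t /s2 /sigma2 c_def; ring.
  - rewrite expected_num_indepE (expected_at_avoidS habc hp).
    rewrite (expected_at_inS habc hp) !expected_at0.
    have -> : A * r ^+ 2 * r + B * s ^+ 2 * s
        = 18 * ((r + s) ^+ 2 - r * s) - 2 * (r * s) * (r + s).
      by rewrite /A /B s1E; field.
    by rewrite rs rDs /t /s2 /sigma2 c_def; ring.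
  - move=> k; rewrite !expected_num_indepE !(expected_at_avoidS habc hp).
    rewrite !(expected_at_inS habc hp) !(expected_at_avoidS habc hp) rs rDs.
    by rewrite /t /s2 /sigma2 c_def; ring.
have D n : (1 / (1 / 2) ^+ n.+1
        * (- 3 * a * s1 - 7 * b * s1 - 5 * c * s1
           + 42 * a * b + 30 * a * c + 70 * b * c + 4 * s1 + s3))
      / ((- ((3 * a + 7 * b + 5 * c - s1 + 5) / s2)) ^+ n.+1 * s1 * s2)
   = A * r ^+ n.
  have -> : - 3 * a * s1 - 7 * b * s1 - 5 * c * s1
      + 42 * a * b + 30 * a * c + 70 * b * c + 4 * s1 + s3 = - s * (18 - 2 * s).
    transitivity ((s1 ^+ 2 + s1 * (18 - 2 * t) - 18 * t + t ^+ 2) / 2).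
      by rewrite s1_sqr /t /s2 /sigma2 /s3 /sigma3 c_def; field.
    by rewrite sE; field.
  have -> : - ((3 * a + 7 * b + 5 * c - s1 + 5) / s2) = 2 / r.
    have -> : 3 * a + 7 * b + 5 * c - s1 + 5 = 2 * s by rewrite sE /t; field.
    by rewrite -[s2]opprK -rs; field; rewrite s_neq0 lt0r_neq0.
  rewrite -[s2]opprK -rs /A !expr_div_n expr1n !exprS.
  have := expf_neq0 n (lt0r_neq0 r_gt0).
  have : (2 : R) ^+ n != 0 by rewrite expf_neq0.
  move: (r ^+ n) (2 ^+ n) => rn twon twon0 rn0; field.
  by rewrite rn0 twon0 s_neq0 !lt0r_neq0.
have ratio : `|s / r| < 1.
  rewrite normrM normfV (gtr0_norm r_gt0) ltr_pdivrMr // mul1r ltr_norml.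
  by rewrite rE sE; apply/andP; split; lra.
rewrite -(cvg_shiftn 2) /=.
under eq_cvg do rewrite D addn2 AB.
have -> : (fun n => (A * r ^+ n.+2 + B * s ^+ n.+2) / (A * r ^+ n.+2))
  = (fun n => 1 + B / A * (s / r) ^+ 2 * (s / r) ^+ n).
  apply/funext => n; rewrite !expr_div_n !exprS expr0.
  have := expf_neq0 n (lt0r_neq0 r_gt0).
  move: (r ^+ n) (s ^+ n) => rn sn rn0; field.
  by rewrite rn0 !lt0r_neq0.
set K := B / A * (s / r) ^+ 2.
suff: (fun n => 1 + K * (s / r) ^+ n) @ \oo --> 1 + K * 0.
  by rewrite mulr0 addr0.
by apply: cvgD; [exact: cvg_cst | apply: cvgMr; exact: cvg_expr].
Qed.
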